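(* There exists a family of COCOA $\mathcal{C}^1, \mathcal{C}^2, \ldots$ such that for each COCOA $\mathcal{C}^k = (A^k_1, \ldots, A^k_k)$ in the family: for all $1 \leq j \leq k$, the history-deterministic co-Büchi automaton $A^k_j$ only has two states; the language of $\mathcal{C}^k$ only has a single residual language; and every deterministic parity automaton $\mathcal{P}^k$ for the language of $\mathcal{C}^k$ needs at least $2^k$ states.
   Context: Here $\mathbb{N}$ contains $0$. For a language $L \subseteq \Sigma^\omega$ over a finite alphabet $\Sigma$ and $u \in \Sigma^*$, the residual language is $L|_u = \{w' \in \Sigma^\omega \mid uw' \in L\}$. Automata. Automata have transition-based acceptance: $\mathcal{A} = (Q,\Sigma,\delta,q_0)$ with finite state set $Q$, initial state $q_0$ and $\delta \subseteq Q \times \Sigma \times Q \times \mathbb{N}$; the last component of a transition is its color. Automata are input-complete, and the color of a transition depends only on its source state and letter. A run is accepting if the lowest color occurring infinitely often along it is even; a word is accepted if it has an accepting run; $\mathcal{L}(\mathcal{A})$ is the set of accepted words. $\mathcal{A}$ is deterministic if for each $(q,x)\in Q\times\Sigma$ there is exactly one $(q',c)$ with $(q,x,q',c)\in\delta$. A (deterministic) automaton of this form is a (deterministic) parity automaton. It is a co-Büchi automaton if its only colors are $1$ (rejecting) and $2$ (accepting). It is history-deterministic if its nondeterminism can be resolved letter by letter by an advice function of the finite prefix read so far, such that for every word in $\mathcal{L}(\mathcal{A})$ the resulting run is accepting. Natural colors. Fix an $\omega$-regular language $L$. For $w = w_0w_1\ldots \in \Sigma^\omega$, the word $w_0\ldots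 w_i \tilde w w_{i+1} w_{i+2}\ldots$ results from a residual language invariant injection of $\tilde w\in\Sigma^*$ at position $i$ if $L|_{w_0\ldots w_i} = L|_{w_0\ldots w_i\tilde w}$. A word $w$ is at home in a color of $i \in \mathbb{N}$ if there exists an (infinite) sequence of injection points $J \subset \mathbb{N}$ such that for all words $w'$ that result from injecting residual language invariant words at word positions in $J$ into $w$, either $w'$ is at home in a color strictly smaller than $i$, or both $w,w' \in L$ and $i$ is even, or both $w,w' \notin L$ and $i$ is odd (for $i=0$ only the latter kind of condition can apply). The natural color of $w$ (w.r.t. $L$) is the minimal color in which $w$ is at home. COCOA. A chain of co-Büchi automata (COCOA) for $L$ is a sequence $(A_1,\ldots,A_n)$ of history-deterministic co-Büchi automata with transition-based acceptance with $\mathcal{L}(A_1)\supset\cdots\supset\mathcal{L}(A_n)$ such that $A_1$ rejects exactly the words of natural color $0$ w.r.t. $L$ and, for each $1\le i\le n$, the words accepted by $A_i$ but rejected by $A_{i+1}$ (if $i<n$) are exactly those of natural color $i$ w.r.t. $L$. The language of the chain is the set of words $w$ such that $w\notin\mathcal{L}(A_1)$ or the highest $i$ with $w\in\mathcal{L}(A_i)$ is even (this set is $L$). *)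

(* Defs.v *)
From mathcomp Require Import all_boot.
From mathcomp Require Import classical_sets.

Set Implicit Arguments.
Unset Strict Implicit.
Unset Printing Implicit Defensive.

Local Open Scope classical_set_scope.

Definition inf_often (P : set nat) : Prop :=
  forall n, exists2 i, n <= i & P i.

Definition word (Sigma : finType) := nat -> Sigma.
Definition language (Sigma : finType) := set (word Sigma).

Section Words.
Variable Sigma : finType.
Implicit Types (w : word Sigma) (u v : seq Sigma) (L : language Sigma).

(* w_0 ... w_{n-1} *)
Definition pref w n : seq Sigma := mkseq w n.

(* The word u w: beyond u, nth returns its default, the right letter of w. *)
Definition wcat u w : word Sigma := fun i => nth (w (i - size u)) u i.

Definition residual L u : language Sigma := [set w | L (wcat u w)].

Definition single_residual L : Prop :=
  forall u v, residual L u = residual L v.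

End Words.

Record automaton (Sigma : finType) := Automaton {
  state : finType;
  init : state;
  trans : state -> Sigma -> state -> nat -> bool;
  trans_complete : forall q x, exists q' c, trans q x q' c;
  trans_color : forall q x q1 c1 q2 c2,
    trans q x q1 c1 -> trans q x q2 c2 -> c1 = c2
}.

Section Automata.
Variable Sigma : finType.
Implicit Types (A : automaton Sigma) (w : word Sigma) (L : language Sigma).

(* A run is given by its sequence rho of states and its sequence col of
   transition colors. *)
Definition run A w (rho : nat -> state A) (col : nat -> nat) : Prop :=
  rho 0 = init A /\ forall i, trans (rho i) (w i) (rho i.+1) (col i).

Definition accepting (col : nat -> nat) : Prop :=
  exists m, [/\ ~~ odd m, inf_often [set i | col i = m]
    & forall m', m' < m -> ~ inf_often [set i | col i = m']].

Definition lang A : language Sigma :=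
  [set w | exists rho col, run (A := A) w rho col /\ accepting col].

Definition deterministic A : Prop :=
  forall (q : state A) x, exists! p : state A * nat, trans q x p.1 p.2.

Definition cobuchi A : Prop :=
  forall (q : state A) x q' c, trans q x q' c -> c = 1 \/ c = 2.

(* The advice f maps the finite prefix read so far to the state reached. *)
Definition history_deterministic A : Prop :=
  exists f : seq Sigma -> state A,
    [/\ f [::] = init A,
        forall u x, exists c, trans (f u) x (f (rcons u x)) c
      & forall w, lang A w ->
          exists2 col, run w (fun i => f (pref w i)) col & accepting col].

Definition omega_regular L : Prop := exists A, lang A = L.

End Automata.

Section NaturalColors.
Variable Sigma : finType.
Variable L : language Sigma.
Implicit Types (w : word Sigma) (inj : nat -> seq Sigma).

(* The word w_0 inj_0 w_1 inj_1 w_2 inj_2 ...; its first m + 1 letters lie in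
   the first m + 1 blocks w_i inj_i, since no block is empty. *)
Definition inject w inj : word Sigma :=
  fun m => nth (w 0) (flatten [seq w i :: inj i | i <- iota 0 m.+1]) m.

(* Since each injected word preserves the residual language of the prefix of
   w, it preserves that of the prefix containing all the earlier injections. *)
Definition invariant_injection (J : set nat) w inj : Prop :=
  (forall i, ~ J i -> inj i = [::]) /\
  forall i, residual L (pref w i.+1) = residual L (pref w i.+1 ++ inj i).

Definition home_cond (below : set (word Sigma)) (i : nat) w : Prop :=
  exists2 J, inf_often J & forall inj, invariant_injection J w inj ->
    let w' := inject w inj in
    [\/ below w', [/\ L w, L w' & ~~ odd i] | [/\ ~ L w, ~ L w' & odd i]].

(* The words at home in a color strictly smaller than i. *)
Fixpoint at_home_below (i : nat) : set (word Sigma) :=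
  if i is j.+1 then
    [set w | at_home_below j w \/ home_cond (at_home_below j) j w]
  else set0.

Definition at_home (i : nat) w : Prop := home_cond (at_home_below i) i w.

Definition natural_color w (i : nat) : Prop :=
  at_home i w /\ forall j, j < i -> ~ at_home j w.

End NaturalColors.

Section Cocoa.
Variables (Sigma : finType) (n : nat) (A : 'I_n -> automaton Sigma).
Implicit Type w : word Sigma.

(* Ordinals start at 0: for i : 'I_n, A i is the (i + 1)-st automaton of the
   chain. *)

Definition first_rejects w : Prop :=
  forall i : 'I_n, i = 0 :> nat -> ~ lang (A i) w.

Record cocoa_for (L : language Sigma) : Prop := CocoaFor {
  cocoa_regular : omega_regular L;
  cocoa_cobuchi : forall i, cobuchi (A i);
  cocoa_hd : forall i, history_deterministic (A i);
  cocoa_strict : forall i j : 'I_n, j = i.+1 :> nat ->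
    lang (A j) `<` lang (A i);
  cocoa_color0 : forall w, first_rejects w <-> natural_color L w 0;
  cocoa_colorS : forall (i : 'I_n) w,
    (lang (A i) w /\ forall j : 'I_n, j = i.+1 :> nat -> ~ lang (A j) w)
    <-> natural_color L w i.+1
}.

Definition cocoa : Prop := exists L, cocoa_for L.

Definition chain_lang : language Sigma :=
  [set w | first_rejects w \/
    exists i : 'I_n, [/\ lang (A i) w,
      forall j : 'I_n, lang (A j) w -> j <= i & ~~ odd i.+1]].

End Cocoa.

(* Main.v *)
(* The letters are pairs (i, b) of a level i < k and a bit b. Among the letters
   occurring infinitely often in a word, let m be the least level; with levels
   counted from 0, the color of the word is m if both letters of level m occur
   infinitely often, and m + 1 otherwise. The i-th automaton of the chain only
   has to decide whether the color is at most i, for which it remembers the last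
   bit seen at level i. Injecting (i, b) into a word of color > i in which
   (i, ~~ b) is rare gives a word of color i + 1; hence this color is the
   natural one. For the lower bound, the Zielonka tree of the language is a
   complete binary tree of depth k: in a deterministic parity automaton, bottom
   components for the letters of level > i together with (i, false) and with
   (i, true) are disjoint, so the number of states doubles at each level. *)
Require Import Defs.
From mathcomp Require Import all_boot.
From mathcomp Require Import boolp classical_sets.

Set Implicit Arguments.
Unset Strict Implicit.
Unset Printing Implicit Defensive.

Local Open Scope classical_set_scope.

(** * Properties that hold infinitely often *)

Lemma inf_oftenS (P Q : set nat) :
  (forall i, P i -> Q i) -> inf_often P -> inf_often Q.
Proof. by move=> PQ Pinf n; have [i le_ni /PQ Qi] := Pinf n; exists i. Qed.

Lemma eq_inf_often (P Q : set nat) :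
  (forall i, P i <-> Q i) -> inf_often P <-> inf_often Q.
Proof. by move=> PQ; split; apply: inf_oftenS => i /PQ. Qed.

Lemma not_inf_often (P : set nat) :
  ~ inf_often P -> exists n, forall i, n <= i -> ~ P i.
Proof.
move=> nPinf; apply: contrapT => nP; apply: nPinf => n; apply: contrapT => nPn.
by apply: nP; exists n => i le_ni Pi; apply: nPn; exists i.
Qed.

Lemma inf_often_or (P Q : set nat) :
  inf_often [set i | P i \/ Q i] <-> inf_often P \/ inf_often Q.
Proof.
split=> [PQinf | [] ]; last 2 first.
- by apply: inf_oftenS => i; left.
- by apply: inf_oftenS => i; right.
have [|/not_inf_often[n nP]] := EM (inf_often P); first by left.
right=> m; have [i] := PQinf (maxn n m).
rewrite geq_max => /andP[le_ni le_mi] [/nP|Qi]; first by move/(_ le_ni).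
by exists i.
Qed.

Lemma inf_often_exists (T : eqType) (s : seq T) (P : T -> set nat) :
  inf_often [set i | exists2 x, x \in s & P x i] ->
  exists2 x, x \in s & inf_often (P x).
Proof.
elim: s => [|y s IHs] Pinf; first by have [i _ []] := Pinf 0.
have /inf_often_or[Py | /IHs[x sx Px]] :
    inf_often [set i | P y i \/ exists2 x, x \in s & P x i].
- apply: inf_oftenS Pinf => i [x]; rewrite inE => /orP[/eqP-> |sx] Px.
    by left.
  by right; exists x.
- by exists y; rewrite ?mem_head.
- by exists x; rewrite // inE sx orbT.
Qed.

Lemma inf_often_shift n (P : set nat) :
  inf_often [set i | P (n + i)] <-> inf_often P.
Proof.
split=> Pinf m.
  have [i le_mi Pi] := Pinf m; exists (n + i) => //.
  exact: leq_trans le_mi (leq_addl _ _).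
have [i le_i Pi] := Pinf (n + m); exists (i - n).
  by rewrite leq_subRL // (leq_trans _ le_i) ?leq_addr.
by rewrite /= subnKC // (leq_trans _ le_i) ?leq_addr.
Qed.

(** * Values taken infinitely often, called recurring below *)

Definition infl (T : Type) (f : nat -> T) : set T :=
  [set x | inf_often [set n | f n = x]].

Lemma infl_periodic (T : eqType) (f : nat -> T) (s : seq T) :
  0 < size s -> (forall i, f i = nth (f 0) s (i %% size s)) ->
  forall x, infl f x <-> x \in s.
Proof.
move=> s_gt0 fE x; split=> [/(_ 0)[i _ /= <-] | sx n].
  by rewrite fE mem_nth // ltn_mod.
exists (n * size s + index x s); first 
  by apply: leq_trans (leq_pmulr n s_gt0) (leq_addr _ _).
by rewrite /= fE modnMDl modn_small ?index_mem // nth_index.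
Qed.

Lemma infl_wcat (Sigma : finType) (u : seq Sigma) (w : word Sigma) :
  infl (wcat u w) = infl w.
Proof.
apply/predeqP => x; rewrite /infl /= -(inf_often_shift (size u)).
apply: eq_inf_often => i /=.
by rewrite /wcat nth_default ?leq_addr // addKn.
Qed.

Lemma infl_nonempty (T : finType) (f : nat -> T) : exists x, infl f x.
Proof.
have [|x _ fx] := @inf_often_exists T (enum T) (fun x => [set n | f n = x]).
  by move=> n; exists n => //; exists (f n); rewrite ?mem_enum.
by exists x.
Qed.

(** * Recurring letters of a word with injections *)

Section Inject.
Variables (Sigma : finType) (w : word Sigma) (inj : nat -> seq Sigma).

Let block i := w i :: inj i.
Let blocks n := flatten [seq block i | i <- iota 0 n].

Let blocks_cat n m :
  blocks (n + m) = blocks n ++ flatten [seq block i | i <- iota n m].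
Proof. by rewrite /blocks iotaD map_cat flatten_cat. Qed.

Let blocksS n : blocks n.+1 = blocks n ++ block n.
Proof. by rewrite -addn1 blocks_cat /= cats0. Qed.

Let leq_size_blocks n : n <= size (blocks n).
Proof.
elim: n => // n IHn; rewrite blocksS size_cat /= addnS ltnS.
exact: leq_trans IHn (leq_addr _ _).
Qed.

(** Blocks are finite and nonempty, so late positions lie in late blocks and late blocks start at
    late positions. *)
Lemma infl_inject x :
  infl (inject w inj) x <-> inf_often [set i | x \in w i :: inj i].
Proof.
split=> xinf n.
  have [m le_nm /= xE] := xinf (size (blocks n)).
  have le_nm1 : n <= m.+1.
    exact: leq_trans (leq_size_blocks n) (leqW le_nm).
  move: xE; rewrite /inject -/(blocks m.+1).
  have := leq_size_blocks m.+1; rewrite -(subnKC le_nm1) blocks_cat.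
  rewrite size_cat subnKC // => lt_m.
  rewrite nth_cat ltnNge le_nm /= => xE.
  have /flatten_mapP[i] : x \in flatten [seq block i | i <- iota n (m.+1 - n)].
    by rewrite -xE mem_nth // ltn_subLR.
  by rewrite mem_iota => /andP[le_ni _] xi; exists i.
have [i le_ni /= xi] := xinf n.
(* The position in the injected word of the first [x] in block [i]. *)
pose p := size (blocks i) + index x (block i).
have le_ip : i <= p := leq_trans (leq_size_blocks i) (leq_addr _ _).
exists p; first exact: leq_trans le_ip.
rewrite /= /inject -/(blocks p.+1) -(subnKC (le_ip : i < p.+1)).
rewrite blocks_cat blocksS -catA nth_cat /p ltnNge leq_addr.
by rewrite [~~ _]/= addKn nth_cat index_mem xi nth_index.
Qed.

End Inject.

(** * Parity of the least color *)

(** The parity condition on a set of colors: [accepting col] unfolds to [even_min (infl col)]. *)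
Definition even_min (C : set nat) : Prop :=
  exists m, [/\ ~~ odd m, C m & forall m', m' < m -> ~ C m'].

Lemma even_min_imp (C C' : set nat) :
  (forall c, C c <-> C' c) -> even_min C -> even_min C'.
Proof.
move=> E [m [m_even Cm m_min]]; exists m; split=> //; first exact/E.
by move=> m' lt_m' /E; apply: m_min.
Qed.

Lemma eq_even_min (C C' : set nat) :
  (forall c, C c <-> C' c) -> even_min C <-> even_min C'.
Proof. by move=> E; split; apply: even_min_imp => c; rewrite E. Qed.

Lemma even_min_up (C : set nat) :
  even_min [set i | exists2 c, c <= i & C c] <-> even_min C.
Proof.
split=> -[m [m_even]] => [[c le_cm Cc] m_min | Cm m_min].
  exists m; split=> // [|m' lt_m' Cm']; last first.
    by apply: (m_min m') => //; exists m'.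
  move: le_cm; rewrite leq_eqVlt => /orP[/eqP<- // | /m_min[]].
  by exists c.
exists m; split=> //; first by exists m.
by move=> m' lt_m' [c /leq_ltn_trans/(_ lt_m')]; apply: m_min.
Qed.

(** The smaller of the two minima is the minimum of the union. *)
Lemma even_minU (C D : set nat) :
  even_min C -> even_min D -> even_min (C `|` D).
Proof.
move=> [m [m_even Cm m_min]] [n [n_even Dn n_min]].
have [lt_mn | le_nm] := ltnP m n; [exists m | exists n]; split=> //.
- by left.
- move=> m' lt_m' [|]; first exact: m_min.
  by apply: n_min; apply: ltn_trans lt_m' lt_mn.
- by right.
- move=> m' lt_m' [|]; last exact: n_min.
  by apply: m_min; apply: leq_trans lt_m' le_nm.
Qed.

(** The minimum of the union is also the minimum of the side that contains it. The contrapositive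
    serves for combining two loops with odd minimal colors. *)
Lemma even_min_setU (C D : set nat) :
  even_min (C `|` D) -> even_min C \/ even_min D.
Proof.
move=> [m [m_even [Cm | Dm] m_min]]; [left | right];
  exists m; split=> // m' lt_m'.
  by move=> Cm'; apply: (m_min m') => //; left.
by move=> Dm'; apply: (m_min m') => //; right.
Qed.

Lemma accepting_cobuchi (col : nat -> nat) :
  (forall n, col n = 1 \/ col n = 2) -> accepting col <-> ~ infl col 1.
Proof.
move=> col12; split=> [[m [m_even m_inf m_min]] | n1].
  have [n _ /= mE] := m_inf 0; have [c1|c2] := col12 n.
    by rewrite -mE c1 in m_even.
  by apply: m_min; rewrite -mE c2.
exists 2; split=> //; last first.
  move=> [|[|//]] _ //.
  by move=> /(_ 0)[n _ /= n0]; have := col12 n; rewrite n0 => -[].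
suff /inf_often_or[] : inf_often [set n | col n = 1 \/ col n = 2] by [].
by move=> n; exists n.
Qed.

(** * Runs of deterministic transition functions *)

Section Trajectory.
Variables (Sigma : finType) (Q : Type).
Variables (step : Q -> Sigma -> Q) (color : Q -> Sigma -> nat).

Fixpoint traj q (w : word Sigma) n : Q :=
  if n is m.+1 then step (traj q w m) (w m) else q.

Definition colors q w n := color (traj q w n) (w n).

Fixpoint colseq q (u : seq Sigma) : seq nat :=
  if u is x :: u' then color q x :: colseq (step q x) u' else [::].

Lemma colseq_cat q u v :
  colseq q (u ++ v) = colseq q u ++ colseq (foldl step q u) v.
Proof. by elim: u q => //= x u IHu q; rewrite IHu. Qed.

Lemma size_colseq q u : size (colseq q u) = size u.
Proof. by elim: u q => //= x u IHu q; rewrite IHu. Qed.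

Lemma foldl_pref q w n : foldl step q (pref w n) = traj q w n.
Proof.
by elim: n => // n IHn; rewrite /pref mkseqS foldl_rcons -/(pref w n) IHn.
Qed.

Lemma nth_colseq d q w n i :
  i < n -> nth d (colseq q (pref w n)) i = colors q w i.
Proof.
elim: n => // n IHn; rewrite ltnS leq_eqVlt => lt_in.
have -> : pref w n.+1 = pref w n ++ [:: w n] by rewrite /pref mkseqS cats1.
rewrite colseq_cat nth_cat size_colseq size_mkseq.
case: ltnP lt_in => [/IHn-> // | le_ni]; rewrite orbF => /eqP->.
by rewrite subnn /= foldl_pref.
Qed.

Lemma traj_wcat1 q x w n :
  traj q (wcat [:: x] w) n.+1 = traj (step q x) w n.
Proof.
elim: n => // n IHn; rewrite [LHS]/= -/(traj q _ n.+1) IHn.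
by rewrite /wcat /= nth_nil subn1.
Qed.

Lemma infl_colors_wcat1 q x w c :
  infl (colors q (wcat [:: x] w)) c <-> infl (colors (step q x) w) c.
Proof.
rewrite /infl /= -(inf_often_shift 1); apply: eq_inf_often => n /=.
by rewrite add1n /colors traj_wcat1 /wcat /= nth_nil subn1.
Qed.

Definition omega_power x0 (u : seq Sigma) : word Sigma :=
  fun i => nth x0 u (i %% size u).

Lemma infl_omega_power x0 u x :
  0 < size u -> infl (omega_power x0 u) x <-> x \in u.
Proof.
move=> u_gt0; apply: infl_periodic => // i.
by apply: set_nth_default; rewrite ltn_mod.
Qed.

(** As [u] leads from [q] back to [q], the run on [u u u ...] repeats the colors of one round. *)
Lemma infl_colors_omega_power x0 q u c :
  0 < size u -> foldl step q u = q ->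
  infl (colors q (omega_power x0 u)) c <-> c \in colseq q u.
Proof.
move=> u_gt0 qu; set w := omega_power x0 u.
have prefE : pref w (size u) = u.
  rewrite -[RHS](mkseq_nth x0); apply/eq_in_map => i.
  by rewrite mem_iota /w /omega_power => lt_iu; rewrite modn_small.
have trajD n : traj q w (n + size u) = traj q w n.
  elim: n => [|n IHn]; first by rewrite -foldl_pref prefE.
  by rewrite addSn /= IHn /w /omega_power modnDr.
have colD m n : colors q w (m * size u + n) = colors q w n.
  elim: m => // m IHm; rewrite mulSn -addnA addnC -IHm /colors trajD.
  by rewrite /w /omega_power modnDr.
apply: infl_periodic => [|i]; rewrite size_colseq //.
by rewrite {1}(divn_eq i (size u)) colD -{2}prefE nth_colseq // ltn_mod.
Qed.

End Trajectory.

(** * Deterministic automata given by functions *)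

Section Deterministic.
Variables (Sigma : finType) (A : automaton Sigma).
Variable step : state A -> Sigma -> state A.
Variable color : state A -> Sigma -> nat.
Hypothesis transE : forall q x q' c,
  trans q x q' c <-> q' = step q x /\ c = color q x.

Lemma lang_deterministic w :
  lang A w <-> accepting (colors step color (init A) w).
Proof.
split=> [[rho [col [[rho0 rhoS] acc]]] | acc]; last first.
  exists (traj step (init A) w), (colors step color (init A) w).
  by split=> //; split=> // i; apply/transE.
have rhoE n : rho n = traj step (init A) w n.
  by elim: n => //= n <-; have /transE[] := rhoS n.
apply: even_min_imp acc => c; apply: eq_inf_often => n /=.
by have /transE[_ ->] := rhoS n; rewrite /colors rhoE.
Qed.

(** The advice is the state in which the unique run on the prefix ends. *)
Lemma history_deterministic_deterministic : history_deterministic A.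
Proof.
exists (foldl step (init A)); split=> // [u x | w Lw].
  exists (color (foldl step (init A) u) x).
  by apply/transE; rewrite foldl_rcons.
exists (colors step color (init A) w); last exact/lang_deterministic.
by split=> // i; apply/transE; rewrite !foldl_pref.
Qed.

End Deterministic.

Section TableAutomaton.
Variables (Sigma Q : finType) (q0 : Q).
Variables (step : Q -> Sigma -> Q) (color : Q -> Sigma -> nat).

Let table q x q' c := (q' == step q x) && (c == color q x).

Let table_complete q x : exists q' c, table q x q' c.
Proof. by exists (step q x), (color q x); rewrite /table !eqxx. Qed.

Let table_color q x q1 c1 q2 c2 : table q x q1 c1 -> table q x q2 c2 -> c1 = c2.
Proof. by move=> /andP[_ /eqP->] /andP[_ /eqP->]. Qed.

Definition table_automaton : automaton Sigma :=
  Automaton q0 table_complete table_color.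

Lemma trans_table (q : state table_automaton) x q' c :
  trans q x q' c <-> q' = step q x /\ c = color q x.
Proof.
by rewrite /= /table; split=> [/andP[/eqP-> /eqP->] | [-> ->]]; rewrite ?eqxx.
Qed.

Lemma lang_table w :
  lang table_automaton w <-> accepting (colors step color q0 w).
Proof. exact: (lang_deterministic trans_table). Qed.

Lemma history_deterministic_table : history_deterministic table_automaton.
Proof. exact: history_deterministic_deterministic trans_table. Qed.

End TableAutomaton.

Lemma deterministic_functions (Sigma : finType) (A : automaton Sigma) :
  deterministic A ->
  exists step color, forall (q : state A) x q' c,
    trans q x q' c <-> q' = step q x /\ c = color q x.
Proof.
move=> detA.
have /choice[f fP] (p : state A * Sigma) : exists r : state A * nat,
    forall q' c, trans p.1 p.2 q' c <-> (q', c) = r.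
  have [r [r_trans r_uniq]] := detA p.1 p.2; exists r => q' c.
  by split=> [/(r_uniq (q', c)) | /esym r_eq]; [| rewrite r_eq in r_trans].
exists (fun q x => (f (q, x)).1), (fun q x => (f (q, x)).2) => q x q' c.
rewrite (fP (q, x)); case: (f _) => q1 c1 /=.
by split=> [[-> ->] | [-> ->]].
Qed.

(** * Colors of words and the chain of automata *)

Section Dominance.
Variable k : nat.
Let letter : finType := ('I_k * bool)%type.
Implicit Types (x : letter) (I : set letter) (w : word letter).

(* For the set I of the letters occurring infinitely often in a word, the least
   i with color_le I i is its natural color. *)
Definition color_le I (i : nat) : Prop :=
  (exists2 x, I x & x.1 < i) \/
  forall b, exists2 x, I x & x.1 = i :> nat /\ x.2 = b.

Lemma color_le_leq I i j : i <= j -> color_le I i -> color_le I j.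
Proof.
rewrite leq_eqVlt => /orP[/eqP<- // | lt_ij].
case=> [[x Ix lt_xi] | /(_ true)[x Ix [xi _]]].
  by left; exists x => //; apply: ltn_trans lt_ij.
by left; exists x => //; rewrite xi.
Qed.

Lemma color_le_subset I I' i : I `<=` I' -> color_le I i -> color_le I' i.
Proof.
move=> sII' [[x /sII' Ix lt_xi] | Ib]; first by left; exists x.
by right=> b; have [x /sII' Ix xib] := Ib b; exists x.
Qed.

(** Some letter recurs, and its level is below [k]. This covers the end of the chain, where there is
    no next automaton. *)
Lemma color_le_full w i : k <= i -> color_le (infl w) i.
Proof.
move=> le_ki; have [x wx] := infl_nonempty w.
by left; exists x => //; apply: leq_trans le_ki.
Qed.

Definition color_is I (c : nat) : Prop :=
  color_le I c /\ forall d, d < c -> ~ color_le I d.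

Lemma even_color I c : color_is I c -> even_min (color_le I) <-> ~~ odd c.
Proof.
move=> [Ic c_min]; split=> [[m [m_even Im m_min]] | c_even]; last by exists c.
have [/c_min // | /m_min // | <- //] := ltngtP m c.
Qed.

Definition level_step i (b : bool) x : bool :=
  if x.1 == i :> nat then x.2 else b.

(** After a last switch the stored bit would be constant, and the other letter of level [i] could
    not recur. Conversely, if bit [b'] died out at level [i], a late switch would store [~~ b'] for
    good and be the last one. *)
Lemma inf_often_switch i b w :
  inf_often [set n | (w n).1 = i :> nat /\ (w n).2 <> traj (level_step i) b w n]
  <-> forall b', exists2 x, infl w x & x.1 = i :> nat /\ x.2 = b'.
Proof.
set beta := traj _ _ _.
have betaS n : beta n.+1 = level_step i (beta n) (w n) by [].
split=> [switch b' | both]; last first.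
  apply: contrapT => /not_inf_often[N no_switch].
  have beta_const n : N <= n -> beta n = beta N.
    elim: n => [|n IHn]; first by rewrite leqn0 => /eqP->.
    rewrite leq_eqVlt ltnS => /orP[/eqP-> // | le_Nn].
    rewrite betaS /level_step -(IHn le_Nn); case: eqP => // wi.
    by apply: contrapT => ne; apply: (no_switch n).
  have [x /(_ N)[n le_Nn /= wn] [xi xb]] := both (~~ beta N).
  apply: (no_switch n) => //=; rewrite wn xi xb beta_const //.
  by split=> //; case: (beta N).
have /inf_often_exists[x _ wx] : inf_often [set n | exists2 x,
    x \in enum letter & w n = x /\ (x.1 = i :> nat /\ x.2 = b')].
  apply: contrapT => /not_inf_often[N no_b'].
  have b'P n : N <= n -> (w n).1 = i :> nat -> (w n).2 = ~~ b'.
    move=> le_Nn wi; case: (eqVneq (w n).2 b') => [wb|]; last first.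
      by move/negPf; case: (w n).2; case: (b').
    by case: (no_b' n le_Nn); exists (w n); rewrite ?mem_enum.
  have [n le_Nn /= [wi wb]] := switch N.
  have beta_const m : n < m -> beta m = ~~ b'.
    elim: m => // m IHm; rewrite ltnS leq_eqVlt => /orP[/eqP<- | lt_nm].
      by rewrite betaS /level_step wi eqxx b'P.
    rewrite betaS /level_step (IHm lt_nm); case: eqP => // /b'P-> //.
    exact: leq_trans le_Nn (ltnW lt_nm).
  have [m lt_nm /= [wmi []]] := switch n.+1.
  by rewrite beta_const // b'P // (leq_trans le_Nn (ltnW lt_nm)).
have [_ _ [_ xib]] := wx 0.
by exists x => //; apply: inf_oftenS wx => n [].
Qed.

(** This form can be checked letter by letter. The initial bit [b] is arbitrary, so it applies to
    the level automata and to each component of the rank automaton. *)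
Lemma color_leP i b w :
  color_le (infl w) i <->
  inf_often [set n | (w n).1 < i \/
    ((w n).1 = i :> nat /\ (w n).2 <> traj (level_step i) b w n)].
Proof.
rewrite inf_often_or inf_often_switch /color_le.
suff -> : (exists2 x, infl w x & x.1 < i) <-> inf_often [set n | (w n).1 < i].
  exact: iff_refl.
split=> [[x wx lt_xi] | low].
  by apply: inf_oftenS wx => n /= ->.
have [|x] := @inf_often_exists letter
    [seq x : letter <- enum letter | x.1 < i] (fun x => [set n | w n = x]).
  apply: inf_oftenS low => n /= lt_wi; exists (w n) => //.
  by rewrite mem_filter /= lt_wi mem_enum.
by rewrite mem_filter => /andP[lt_xi _] wx; exists x.
Qed.

Definition level_color i (b : bool) x : nat :=
  if (x.1 < i) || (x.1 == i :> nat) && (x.2 != b) then 1 else 2.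

(* The state is the bit of the last letter read at level i; letters of lower
   level are rejecting, and so are those that change the state. *)
Definition level_automaton (i : 'I_k) : automaton letter :=
  table_automaton false (level_step i) (level_color i).

Lemma lang_level i w : lang (level_automaton i) w <-> ~ color_le (infl w) i.
Proof.
rewrite /level_automaton lang_table accepting_cobuchi; last first.
  by move=> n; rewrite /colors /level_color; case: ifP; [left | right].
rewrite (color_leP i false) /infl /=.
suff E : inf_often [set n | colors (level_step i) (level_color i) false w n = 1]
    <-> inf_often [set n | (w n).1 < i \/
      ((w n).1 = i :> nat /\ (w n).2 <> traj (level_step i) false w n)].
  by rewrite E.
apply: eq_inf_often => n; rewrite /= /colors /level_color.
case: ifP => [/orP[lt_wi | /andP[/eqP wi /eqP wb]] | /negbT].
- by split=> // _; left.
- by split=> // _; right.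
rewrite negb_or negb_and negbK => /andP[/negPf nlt /orP neq].
split=> // -[| [wi wb]]; first by rewrite nlt.
by case: neq => [/eqP | /eqP].
Qed.

(** * A deterministic parity automaton for the language *)

Definition rank_step (s : {ffun 'I_k -> bool}) x : {ffun 'I_k -> bool} :=
  [ffun i : 'I_k => level_step i (s i) x].

Definition rank_color (s : {ffun 'I_k -> bool}) x : nat :=
  if x.2 != s x.1 then x.1 : nat else x.1.+1.

Lemma traj_rank s w n (i : 'I_k) :
  traj rank_step s w n i = traj (level_step i) (s i) w n.
Proof. by elim: n => //= n IHn; rewrite ffunE IHn. Qed.

(** A transition has color at most [i] exactly if its letter has level below [i], or has level [i]
    and switches the bit: these are the events of [color_leP]. *)
Lemma rank_color_le s w i :
  inf_often [set n | colors rank_step rank_color s w n <= i]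
  <-> color_le (infl w) i.
Proof.
(* For [i >= k] no letter has level [i], so the default bit is never compared. *)
pose b := if insub i is Some j then s j else false.
rewrite (color_leP i b); apply: eq_inf_often => n /=.
rewrite /colors /rank_color traj_rank.
have trajE : (w n).1 = i :> nat ->
    traj (level_step (w n).1) (s (w n).1) w n = traj (level_step i) b w n.
  by move=> wi; rewrite /b -wi valK.
case: eqP => [wb | nwb] /=.
  split=> [lt_wi | [// | [wi]]]; first by left.
  by rewrite -(trajE wi) -wb.
rewrite leq_eqVlt; split=> [/orP[/eqP wi | lt_wi] | [lt_wi | [-> _]]].
- by right; rewrite -(trajE wi).
- by left.
- by rewrite lt_wi orbT.
- by rewrite eqxx.
Qed.

Definition rank_automaton : automaton letter :=
  table_automaton [ffun=> false] rank_step rank_color.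

Lemma lang_rank w : lang rank_automaton w <-> even_min (color_le (infl w)).
Proof.
rewrite /rank_automaton lang_table; set col := colors _ _ _ _.
apply: (iff_trans (iff_sym (even_min_up (infl col)))); apply: eq_even_min => i.
rewrite -(rank_color_le [ffun=> false]) -/col.
split=> [[c le_ci] | le_col].
  by apply: inf_oftenS => n /= ->.
(* Among the finitely many colors up to [i], one recurs. *)
have [|c] := @inf_often_exists nat (iota 0 i.+1) (fun c => [set n | col n = c]).
  by apply: inf_oftenS le_col => n le_i; exists (col n); rewrite ?mem_iota.
by rewrite mem_iota => /andP[_ le_ci] col_c; exists c.
Qed.

Lemma level_hd i : history_deterministic (level_automaton i).
Proof. exact: history_deterministic_table. Qed.

Lemma level_cobuchi i : cobuchi (level_automaton i).
Proof.
move=> q x q' c /trans_table[_ ->]; rewrite /level_color.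
by case: ifP; [left | right].
Qed.

Lemma first_rejectsP w :
  first_rejects level_automaton w <-> color_le (infl w) 0.
Proof.
split=> [rej | w0 i i0]; last by rewrite lang_level i0.
(* For [k = 0] the chain is empty and [first_rejects] holds vacuously. *)
have [le_k0 | lt_0k] := leqP k 0; first exact: color_le_full.
apply: contrapT => n0; apply: (rej (Ordinal lt_0k)) => //.
exact/lang_level.
Qed.

Lemma chain_langE : chain_lang level_automaton = lang rank_automaton.
Proof.
apply/predeqP => w; rewrite lang_rank; split.
  case=> [/first_rejectsP w0 | [i [/lang_level nwi wmax i_odd]]].
    by exists 0.
  (* Ordinals start at 0: if [i] is the last accepting index, the color of [w] is [i.+1]. *)
  exists i.+1; split=> // [|m].
    have [le_ki | lt_ik] := leqP k i.+1; first exact: color_le_full.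
    apply: contrapT => nwi1; suff: i < i by rewrite ltnn.
    by apply: (wmax (Ordinal lt_ik)); apply/lang_level.
  by rewrite ltnS => le_mi /(color_le_leq le_mi).
move=> [[|m] [m_even wm m_min]]; first by left; apply/first_rejectsP.
have nwm := m_min m (ltnSn m).
have lt_mk : m < k by rewrite ltnNge; apply/negP => /(color_le_full w).
right; exists (Ordinal lt_mk); split=> //; first exact/lang_level.
move=> j /lang_level nwj; rewrite leqNgt; apply/negP => lt_mj.
by apply: nwj; apply: color_le_leq wm.
Qed.

(** * Natural colors of the language *)

Local Notation L := (lang rank_automaton).

(** Membership depends only on the recurring letters, which a finite prefix does not affect. Hence
    every injection is residual language invariant. *)
Lemma residualE u : residual L u = L.
Proof. by apply/predeqP => w; rewrite /residual /= !lang_rank infl_wcat. Qed.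

Lemma infl_inject_sub w inj : infl w `<=` infl (inject w inj).
Proof.
move=> x wx; apply/infl_inject; apply: inf_oftenS wx => i /= <-.
by rewrite mem_head.
Qed.

(** The induction step for natural colors. Injections only add recurring letters, so they never
    raise the color; if the result still has color [i], then so has [w]. A word of color above [i]
    can be brought to color [i.+1], which has the wrong parity. *)
Lemma home_condP i w :
  home_cond L [set w | exists2 d, d < i & color_le (infl w) d] i w
  <-> color_le (infl w) i.
Proof.
split=> [[J Jinf home] | wi].
  apply: contrapT => nwi.
  have lt_ik : i < k by rewrite ltnNge; apply/negP => /(color_le_full w).
  pose oi := Ordinal lt_ik.
  (* Injecting (i, b) infinitely often changes the color of w to i + 1. *)
  have [b nwb] : exists b, ~ infl w (oi, ~~ b).
    apply: contrapT => allb; apply: nwi; right=> b.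
    exists (oi, b) => //; apply: contrapT => nwb.
    by apply: allb; exists (~~ b); rewrite negbK.
  pose inj n := if `[< J n >] then [:: (oi, b)] else [::].
  have inv : invariant_injection L J w inj.
    split=> n; last by rewrite !residualE.
    by rewrite /inj; case: asboolP.
  have inflE x : infl (inject w inj) x -> infl w x \/ x = (oi, b).
    move=> /infl_inject winj; have : inf_often [set n | w n = x \/ x = (oi, b)].
      apply: inf_oftenS winj => n /=; rewrite inE => /orP[/eqP-> |].
        by left.
      by rewrite /inj; case: ifP => // _; rewrite inE => /eqP->; right.
    by move/inf_often_or => [wx | /(_ 0)[n _ xE]]; [left | right].
  have winj : infl (inject w inj) (oi, b).
    apply/infl_inject; apply: inf_oftenS Jinf => n Jn.
    by rewrite /= /inj asboolT // !inE eqxx orbT.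
  (* The letter [(i, b)] now recurs, but [(i, ~~ b)] still does not, so the color is not [i]. *)
  have col_inj : color_is (infl (inject w inj)) i.+1.
    split=> [|d]; first by left; exists (oi, b).
    rewrite ltnS => le_di /(color_le_leq le_di)[[x /inflE[wx|->] lt_xi] | both].
    - by apply: nwi; left; exists x.
    - by rewrite ltnn in lt_xi.
    - have [[j c] /inflE[wx|[_ ->]]] := both (~~ b); last first.
        by move=> [_ /= bE]; case: (b) bE.
      by move=> /= [jE cE]; apply: nwb; rewrite -cE -(@ord_inj _ j oi jE).
  have := home inj inv; rewrite /= !(propext (lang_rank _)).
  rewrite (propext (even_color col_inj)) negbK.
  case=> [[d lt_di wd] | [_ i_odd /negP//] | [_ ni_even i_odd]] //.
  by case: col_inj => _ /(_ d (ltnW lt_di)).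
(* Every position may be an injection point, since no injection raises the color. *)
exists setT => [n|inj _]; first by exists n.
set w' := inject w inj; have w'i : color_le (infl w') i.
  exact: color_le_subset (@infl_inject_sub w inj) wi.
have [w'lt | w'nlt] := EM (exists2 d, d < i & color_le (infl w') d).
  by constructor 1.
have w'is : color_is (infl w') i.
  by split=> // d lt_di w'd; apply: w'nlt; exists d.
have wis : color_is (infl w) i.
  split=> // d lt_di wd; apply: w'nlt; exists d => //.
  exact: color_le_subset (@infl_inject_sub w inj) wd.
rewrite /= !(propext (lang_rank _)).
rewrite (propext (even_color w'is)) (propext (even_color wis)).
by have [i_odd | i_even] := boolP (odd i); [constructor 3 | constructor 2].
Qed.

Lemma at_home_belowE i :
  at_home_below L i = [set w | exists2 d, d < i & color_le (infl w) d].
Proof.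
elim: i => [|i IHi]; apply/predeqP => w /=; first by split=> // -[].
rewrite IHi home_condP; split=> [[[d lt_di wd] | wi] | [d]].
- by exists d => //; apply: ltnW.
- by exists i.
- rewrite ltnS leq_eqVlt => /orP[/eqP-> wi | lt_di wd]; first by right.
  by left; exists d.
Qed.

Lemma at_homeE i w : at_home L i w <-> color_le (infl w) i.
Proof. by rewrite /at_home at_home_belowE home_condP. Qed.

Lemma natural_colorE w i : natural_color L w i <-> color_is (infl w) i.
Proof.
by split=> -[/at_homeE wi w_min]; split=> // d /w_min nwd /at_homeE.
Qed.

Lemma level_cocoa : cocoa_for level_automaton L.
Proof.
split.
- by exists rank_automaton.
- exact: level_cobuchi.
- exact: level_hd.
- move=> i j ji; split=> [w /lang_level nwj | sub].
    apply/lang_level => wi; apply: nwj; apply: color_le_leq wi.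
    by rewrite ji leqnSn.
  (* A word of color [i.+1]: accepted at index [i], rejected at index [j = i.+1]. *)
  pose w : word letter := fun=> (i, false).
  have wx x : infl w x -> x = (i, false) by move=> /(_ 0)[].
  have /sub/lang_level[] : lang (level_automaton i) w.
    apply/lang_level => -[[x /wx-> ] | /(_ true)[x /wx-> []//]].
    by rewrite ltnn.
  by left; exists (i, false); rewrite ?ji // => n; exists n.
- move=> w; rewrite first_rejectsP natural_colorE.
  by split=> [w0 | []]; [split | ].
- move=> i w; rewrite natural_colorE.
  split=> [[/lang_level nwi next] | [wi1 w_min]].
    split=> [|d].
      have [le_ki | lt_ik] := leqP k i.+1; first exact: color_le_full.
      apply: contrapT => nwi1; apply: (next (Ordinal lt_ik)) => //.
      exact/lang_level.
    by rewrite ltnS => le_di /(color_le_leq le_di).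
  split; first by apply/lang_level; apply: w_min.
  by move=> j ji; rewrite lang_level ji.
Qed.

End Dominance.

(** * Reachability under restricted letters and bottom components *)

Section Reach.
Variables (Sigma Q : finType) (step : Q -> Sigma -> Q).
Implicit Type Y : pred Sigma.

Definition reach Y : rel Q :=
  connect (fun q q' => [exists x, Y x && (q' == step q x)]).

Lemma reachP Y q q' :
  reflect (exists2 u, all Y u & foldl step q u = q') (reach Y q q').
Proof.
apply: (iffP connectP) => [[p] | [u]].
  elim: p q => [|q1 p IHp] q /=; first by move=> _ ->; exists [::].
  move=> /andP[/existsP[x /andP[Yx /eqP q1E]] /IHp{}IHp] /IHp[u Yu uE].
  by exists (x :: u); rewrite /= ?Yx // -q1E.
elim: u q => [|x u IHu] q /=; first by move=> _ <-; exists [::].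
move=> /andP[Yx /IHu{}IHu] /IHu[p pp pE]; exists (step q x :: p) => //=.
by rewrite pp andbT; apply/existsP; exists x; rewrite Yx /=.
Qed.

Lemma sub_reach Y Y' q : subpred Y Y' -> subpred (reach Y q) (reach Y' q).
Proof.
move=> sYY' q' /reachP[u Yu uE]; apply/reachP; exists u => //.
exact: sub_all Yu.
Qed.

(** Take [p] with the fewest reachable states. A state [s] reachable from [p] reaches a subset of
    these, which by minimality is all of them, including [p]. *)
Lemma reach_bottom Y q :
  exists2 p, reach Y q p & forall s, reach Y p s -> reach Y s p.
Proof.
have qq : reach Y q q := connect0 _ q.
have [p qp p_min] := arg_minnP (fun p => #|reach Y p|) qq.
exists p => // s ps; have sub : reach Y s \subset reach Y p.
  by apply/fintype.subsetP => t; apply: connect_trans ps.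
have : p \in reach Y p := connect0 _ p.
have /p_min le_card : reach Y q s by apply: connect_trans qp ps.
have /subset_cardP eqr : #|reach Y s| = #|reach Y p|.
  by apply/eqP; rewrite eqn_leq subset_leq_card.
by rewrite -(eqr sub).
Qed.

End Reach.

(** * Lower bound for deterministic parity automata *)

Section LowerBound.
Variables (k : nat) (Q : finType).
Let letter : finType := ('I_k * bool)%type.
Variables (step : Q -> letter -> Q) (color : Q -> letter -> nat).
Implicit Types (x : letter) (w : word letter) (u : seq letter).

Definition recognizes (q : Q) : Prop :=
  forall w, accepting (colors step color q w) <-> even_min (color_le (infl w)).

(** A prepended letter changes neither the recurring letters nor the recurring colors. *)
Lemma recognizes_step q x : recognizes q -> recognizes (step q x).
Proof.
move=> rec_q w; rewrite -(infl_wcat [:: x]) -rec_q.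
by apply: eq_even_min => c; apply: iff_sym; apply: infl_colors_wcat1.
Qed.

Lemma recognizes_reach Y q q' :
  recognizes q -> reach step Y q q' -> recognizes q'.
Proof.
move=> rec_q /reachP[u _ <-].
by elim: u q rec_q => //= x u IHu q rec_q; apply/IHu/recognizes_step.
Qed.

(** Apply [recognizes] to [u u u ...]: its recurring letters are those of [u], and its recurring
    colors are those of the loop. *)
Lemma recognizes_loop q u : recognizes q -> 0 < size u -> foldl step q u = q ->
  even_min [set c | c \in colseq step color q u]
  <-> even_min (color_le [set x | x \in u]).
Proof.
case: u => // x u; set v := x :: u => rec_q v_gt0 qv.
have <- : infl (omega_power x v) = [set y | y \in v].
  by apply/predeqP => y; apply: infl_omega_power.
rewrite -rec_q; apply: eq_even_min => c; apply: iff_sym.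
exact: infl_colors_omega_power.
Qed.

Definition above (j : nat) : pred letter := fun x => j <= x.1.

(** For [j < k], these are the two maximal subsets of [above j] whose color has the other parity. *)
Definition branch (j : nat) (b : bool) : pred letter :=
  fun x => (j < x.1) || (x.1 == j :> nat) && (x.2 == b).

Lemma color_is_branch (i : 'I_k) b u :
  all (branch i b) u -> (i, b) \in u -> color_is [set x | x \in u] i.+1.
Proof.
move=> /allP u_branch ub; split=> [|d]; first by left; exists (i, b).
rewrite ltnS => le_di /(color_le_leq le_di).
case=> [[x /u_branch] | /(_ (~~ b))[x /u_branch]].
  by case/orP=> [lt_ix /(ltn_trans lt_ix) | /andP[/eqP-> _]]; rewrite ltnn.
case/orP=> [lt_ix [xi] | /andP[_ /eqP->] [_]]; first by rewrite xi ltnn in lt_ix.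
by case: b {ub u_branch}.
Qed.

(** Reading [(i, b)] from [s] stays in the bottom component, from which [p] and then [s] can be
    reached again. *)
Lemma bottom_loop (i : 'I_k) b p s :
  (forall t, reach step (branch i b) p t -> reach step (branch i b) t p) ->
  reach step (branch i b) p s ->
  exists u, [/\ all (branch i b) u, (i, b) \in u & foldl step s u = s].
Proof.
move=> p_bottom ps.
have ib : branch i b (i, b) by rewrite /branch /= !eqxx orbT.
have : reach step (branch i b) p (step s (i, b)).
  apply: connect_trans ps _; apply/reachP.
  by exists [:: (i, b)]; rewrite //= ib.
move=> /p_bottom back; have /reachP[u u_branch uE] := connect_trans back ps.
by exists ((i, b) :: u); rewrite /= ib mem_head.
Qed.

(* Loops over branch i false and branch i true have minimal colors of the same
   parity as i + 1; the combined loop through a common state inherits that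
   parity, although it should have the parity of i. *)
Lemma disjoint_branches (i : 'I_k) p0 p1 s :
  recognizes s ->
  (forall t, reach step (branch i false) p0 t ->
             reach step (branch i false) t p0) ->
  (forall t, reach step (branch i true) p1 t ->
             reach step (branch i true) t p1) ->
  reach step (branch i false) p0 s -> reach step (branch i true) p1 s -> False.
Proof.
move=> rec_s bot0 bot1 /(bottom_loop bot0)[u [u_branch uib su]].
move=> /(bottom_loop bot1)[v [v_branch vib sv]].
have nonempty b (t : seq letter) : (i, b) \in t -> 0 < size t by case: t.
have /propext := recognizes_loop rec_s (nonempty _ _ uib) su.
have /propext := recognizes_loop rec_s (nonempty _ _ vib) sv.
rewrite (propext (even_color (color_is_branch u_branch uib))).
rewrite (propext (even_color (color_is_branch v_branch vib))) /= negbK.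
have suv : foldl step s (u ++ v) = s by rewrite foldl_cat su.
have uv_gt0 : 0 < size (u ++ v) by rewrite size_cat addn_gt0 (nonempty _ _ uib).
have /propext := recognizes_loop rec_s uv_gt0 suv.
have uv_is : color_is [set x | x \in u ++ v] i.
  split=> [|d lt_di].
    right=> b; exists (i, b) => //=; rewrite mem_cat.
    by case: b; rewrite ?uib ?vib ?orbT.
  have low x : x \in u ++ v -> i <= x.1.
    rewrite mem_cat => /orP[/(allP u_branch) | /(allP v_branch)];
      by case/orP=> [/ltnW | /andP[/eqP->]].
  case=> [[x /low le_ix lt_xd] | /(_ true)[x /low le_ix [xd _]]].
    by have := leq_trans (leq_ltn_trans le_ix lt_xd) (ltnW lt_di); rewrite ltnn.
  by rewrite xd leqNgt lt_di in le_ix.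
rewrite (propext (even_color uv_is)) colseq_cat su.
have -> : [set c | c \in colseq step color s u ++ colseq step color s v] =
    [set c | c \in colseq step color s u] `|`
    [set c | c \in colseq step color s v].
  apply/predeqP => c /=; rewrite mem_cat.
  by split=> [/orP[] | []]; [left | right | move=> -> | move=> ->; rewrite orbT].
(* For odd [i] both loops have an even minimal color, hence so has their union; for even [i] neither
   has one, hence nor has the union. *)
move=> uvE vE uE; have [i_odd | i_even] := boolP (odd i).
  have : ~~ odd i by rewrite -uvE; apply: even_minU; rewrite ?uE ?vE.
  by rewrite i_odd.
have : ~~ odd i := i_even.
rewrite -uvE => /even_min_setU; rewrite uE vE.
by rewrite (negPf i_even); case.
Qed.

(** The bottom components of the two branches are disjoint, and each has at least [2 ^ d] states by
    induction, so the bound doubles. *)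
Lemma card_reach_above d j q :
  j + d = k -> recognizes q -> 2 ^ d <= #|reach step (above j) q|.
Proof.
elim: d j q => [|d IHd] j q jd rec_q.
  by rewrite expn0; apply/card_gt0P; exists q; apply: connect0.
have lt_jk : j < k by rewrite -jd addnS ltnS leq_addr.
pose i := Ordinal lt_jk.
have branch_above b : subpred (branch i b) (above j).
  by move=> x; rewrite /above => /orP[/ltnW | /andP[/eqP-> _]].
have [p0 qp0 bot0] := reach_bottom step (branch i false) q.
have [p1 qp1 bot1] := reach_bottom step (branch i true) q.
have sub b p : reach step (branch i b) q p ->
    subpred (reach step (branch i b) p) (reach step (above j) q).
  move=> qp s ps; apply: sub_reach (branch_above b) _ _.
  exact: connect_trans qp ps.
(* Either branch keeps all letters of level above [j], so the induction hypothesis at [p] counts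
   states inside its component. *)
have big b p : reach step (branch i b) q p ->
    2 ^ d <= #|reach step (branch i b) p|.
  move=> qp; apply: leq_trans (_ : #|reach step (above j.+1) p| <= _).
    by apply: IHd; [rewrite addSnnS | apply: recognizes_reach qp].
  apply/subset_leq_card/fintype.subsetP; apply: sub_reach => x lt_jx.
  by apply/orP; left.
rewrite expnS mul2n -addnn.
apply: leq_trans (leq_add (big _ _ qp0) (big _ _ qp1)) _.
rewrite -cardUI [X in _ + X]eq_card0 ?addn0 => [|s].
  apply/subset_leq_card/fintype.subsetP => s; rewrite inE => /orP[].
    exact: sub qp0 _.
  exact: sub qp1 _.
rewrite !inE; apply/negP => /andP[p0s p1s].
apply: (disjoint_branches _ bot0 bot1 p0s p1s).
by apply: recognizes_reach p0s; apply: recognizes_reach qp0.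
Qed.

End LowerBound.

Theorem theorem4p3 :
  exists (Sigma : nat -> finType)
         (C : forall k : nat, 'I_k -> automaton (Sigma k)),
  forall k : nat, 0 < k ->
    [/\ cocoa (C k),
        forall j : 'I_k, #|state (C k j)| = 2,
        single_residual (chain_lang (C k))
      & forall P : automaton (Sigma k),
          deterministic P -> lang P = chain_lang (C k) ->
          2 ^ k <= #|state P| ].
Proof.
exists (fun k => ('I_k * bool)%type), level_automaton => k _; split.
- by exists (lang (rank_automaton k)); apply: level_cocoa.
- by move=> j; rewrite card_bool.
- by move=> u v; rewrite chain_langE !residualE.
move=> P /deterministic_functions[step [color transE]] PE.
(* All letters have level at least [0], so these are the states reachable in [P]. *)
apply: leq_trans (max_card (reach step (above 0) (init P))).
apply: (card_reach_above (color := color)) => // w.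
by rewrite -(lang_deterministic transE) PE chain_langE lang_rank.
Qed.
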